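(* Let $f_{\phi}:\mathbb{R}^D\to\mathbb{R}^H$ be the encoder of a Natural Posterior Network model, given by a neural network with piecewise (leaky) ReLU activations, so that $f_{\phi}$ is continuous and piecewise affine: there is a finite collection of affine regions $Q^{(1)},\dots,Q^{(R)}$ covering $\mathbb{R}^D$ such that $f_{\phi}(\mathbf{x}) = V^{(l)}\mathbf{x} + a^{(l)}$ for $\mathbf{x}\in Q^{(l)}$, with $V^{(l)}\in\mathbb{R}^{H\times D}$ and $a^{(l)}\in\mathbb{R}^H$. Suppose that every matrix $V^{(l)}$ has linearly independent rows. Let $\mathbb{P}(\mathbf{z}\mid\boldsymbol{\omega})$ be a probability density function on the latent space $\mathbb{R}^H$ which has bounded derivatives. Then for almost every $\mathbf{x}\in\mathbb{R}^D$, $$\mathbb{P}(f_{\phi}(\delta\cdot\mathbf{x})\mid\boldsymbol{\omega}) \longrightarrow 0 \quad\text{as } \delta\to\infty .$$ In particular, the predicted evidence $n(\delta\mathbf{x}) = N_H\,\mathbb{P}(f_{\phi}(\delta\mathbf{x})\mid\boldsymbol{\omega})$ (for any constant $N_H>0$) tends to $0$ as $\delta\to\infty$.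
   Context: A Natural Posterior Network consists of an encoder $f_{\phi}$ mapping an input $\mathbf{x}\in\mathbb{R}^D$ to a latent vector $\mathbf{z}=f_{\phi}(\mathbf{x})\in\mathbb{R}^H$, a decoder $g_{\psi}$ (which plays no role in this statement), and a normalized density $\mathbb{P}(\mathbf{z}\mid\boldsymbol{\omega})$ on $\mathbb{R}^H$ (e.g. a normalizing flow). For an input $\mathbf{x}$, the evidence (pseudo-count) is defined as $n = N_H\,\mathbb{P}(f_{\phi}(\mathbf{x})\mid\boldsymbol{\omega})$ with a fixed constant $N_H>0$ (the certainty budget). *)

(* Defs.v *)
From HB Require Import structures.
From mathcomp Require Import all_boot all_order all_algebra.
From mathcomp Require Import all_classical all_reals all_analysis.
Set Implicit Arguments. Unset Strict Implicit. Unset Printing Implicit Defensive.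
Import Order.TTheory GRing.Theory Num.Theory.
Import numFieldNormedType.Exports.
Local Open Scope classical_set_scope.
Local Open Scope ring_scope.

Definition box (R : realType) (n : nat) (a b : 'cV[R]_n) : set 'cV[R]_n :=
  [set x | forall i : 'I_n, a i ord0 <= x i ord0 <= b i ord0].

(* volume of the box [a,b] (assuming a <= b componentwise) *)
Definition box_vol (R : realType) (n : nat) (a b : 'cV[R]_n) : R :=
  \prod_(i < n) (b i ord0 - a i ord0).

Definition lebesgue_outer (R : realType) (n : nat) (A : set 'cV[R]_n) : \bar R :=
  ereal_inf [set s | exists a b : nat -> 'cV[R]_n,
     (forall k (i : 'I_n), a k i ord0 <= b k i ord0) /\
     A `<=` \bigcup_k box (a k) (b k) /\
     s = (\sum_(k <oo) (box_vol (a k) (b k))%:E)%E].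

Definition lebesgue_null (R : realType) (n : nat) (N : set 'cV[R]_n) : Prop :=
  lebesgue_outer N = 0%E.

(* Lebesgue integral over R^n of a nonnegative function, via the layer-cake
   formula  \int g = \int_0^oo lambda_n({g > t}) dt *)
Definition lebesgue_integral_nonneg (R : realType) (n : nat)
    (g : 'cV[R]_n -> R) : \bar R :=
  (\int[@lebesgue_measure R]_(t in `[0%R, +oo[%classic)
      lebesgue_outer [set z | (t < g z)%R])%E.

Definition is_pdf (R : realType) (n : nat) (P : 'cV[R]_n -> R) : Prop :=
  (forall z, 0 <= P z) /\ lebesgue_integral_nonneg P = 1%E.

Definition bounded_derivative (R : realType) (n : nat) (P : 'cV[R]_n -> R) : Prop :=
  (forall z, differentiable P z) /\
  exists M : R, forall z v : 'cV[R]_n, `|'D_v P z| <= M * `|v|.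

Definition piecewise_affine (R : realType) (D H r : nat)
    (f : 'cV[R]_D -> 'cV[R]_H) (Q : 'I_r -> set 'cV[R]_D)
    (V : 'I_r -> 'M[R]_(H, D)) (a : 'I_r -> 'cV[R]_H) : Prop :=
  (forall x, exists l, Q l x) /\
  (forall l x, Q l x -> f x = V l *m x + a l).

(* Main.v *)
(* Off the null set of points x with V_l x = 0 for some region l (each kernel lies in
   a hyperplane, and hyperplanes are null), every affine piece V_l (d x) + a_l has
   norm growing linearly in d, so |f (d x)| -> +oo and it suffices that P vanishes at
   infinity.  If it did not, P >= e would hold at infinitely many points at mutual
   distance > 2s; since P is Lipschitz, P > e/2 on disjoint cubes of side 2s around
   them, so every superlevel set {P > t}, t < e/2, has arbitrarily large outer measure
   and the layer-cake integral of P cannot be 1.  The lower bound on the outer measure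
   of finitely many disjoint boxes comes from integrating indicator functions one
   coordinate at a time, which only needs monotonicity of the integral. *)

Require Import Defs.
From HB Require Import structures.
From mathcomp Require Import all_boot all_order all_algebra.
From mathcomp Require Import all_classical all_reals all_analysis.
From mathcomp Require Import measurable_realfun ring lra.
Set Implicit Arguments. Unset Strict Implicit. Unset Printing Implicit Defensive.
Import Order.TTheory GRing.Theory Num.Theory.
Import numFieldNormedType.Exports.
Local Open Scope classical_set_scope.
Local Open Scope ring_scope.
Local Open Scope ereal_scope.

Section lebesgue_outer.
Variables (R : realType) (n : nat).
Implicit Types A B : set 'cV[R]_n.

Lemma box_vol_ge0 (a b : 'cV[R]_n) : (forall i, a i ord0 <= b i ord0)%R ->
  (0 <= box_vol a b)%R.
Proof. by move=> ab; apply: prodr_ge0 => i _; rewrite subr_ge0. Qed.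

Lemma lebesgue_outer_ge0 A : 0 <= lebesgue_outer A.
Proof.
apply: le_ereal_inf_tmp => _ [a [b [ab [_ ->]]]].
by apply: nneseries_ge0 => k _ _; rewrite lee_fin box_vol_ge0.
Qed.

Lemma lebesgue_outer_le_cover A (a b : nat -> 'cV[R]_n) :
  (forall k i, (a k i ord0 <= b k i ord0)%R) ->
  A `<=` \bigcup_k box (a k) (b k) ->
  lebesgue_outer A <= \sum_(k <oo) (box_vol (a k) (b k))%:E.
Proof. by move=> ab Acov; apply: ereal_inf_lbound; exists a, b. Qed.

Lemma le_lebesgue_outer A B : A `<=` B -> lebesgue_outer A <= lebesgue_outer B.
Proof.
move=> AB; apply: le_ereal_inf => _ [a [b [ab [Bcov ->]]]].
by exists a, b; split => //; split => //; apply: subset_trans Bcov.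
Qed.

Lemma lebesgue_null_sub A B : A `<=` B -> lebesgue_null B -> lebesgue_null A.
Proof.
move=> AB nB; apply/eqP; rewrite eq_le lebesgue_outer_ge0 andbT.
by rewrite -nB le_lebesgue_outer.
Qed.

Lemma lebesgue_nullP A : (forall e : R, (0 < e)%R -> exists a b : nat -> 'cV[R]_n,
   (forall k i, (a k i ord0 <= b k i ord0)%R) /\
   A `<=` \bigcup_k box (a k) (b k) /\
   \sum_(k <oo) (box_vol (a k) (b k))%:E <= e%:E) -> lebesgue_null A.
Proof.
move=> Acov; apply/eqP; rewrite eq_le lebesgue_outer_ge0 andbT.
apply/lee_addgt0Pr => e e0; rewrite add0e.
have [a [b [ab [Aab le_e]]]] := Acov e e0.
exact: le_trans (lebesgue_outer_le_cover ab Aab) le_e.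
Qed.

Lemma lebesgue_null_fin_cover A :
  (0 < n)%N ->
  (forall e : R, (0 < e)%R -> exists (I : finType) (a b : I -> 'cV[R]_n),
     (forall k i, (a k i ord0 <= b k i ord0)%R) /\
     A `<=` \bigcup_k box (a k) (b k) /\
     (\sum_k box_vol (a k) (b k) <= e)%R) ->
  lebesgue_null A.
Proof.
move=> n0 Acov; apply: lebesgue_nullP => e e0.
have [I [a [b [ab [Aab le_e]]]]] := Acov e e0.
(* pad with degenerate boxes, which have volume 0 only because n > 0 *)
pose pad (c : I -> 'cV[R]_n) m :=
  oapp (fun i : 'I_#|I| => c (enum_val i)) 0%R (insub m).
have padE c (i : 'I_#|I|) : pad c i = c (enum_val i) by rewrite /pad valK.
have vol_pad m : (#|I| <= m)%N -> box_vol (pad a m) (pad b m) = 0%R.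
  move=> Im; rewrite /pad insubN -?leqNgt // /box_vol (bigD1 (Ordinal n0)) //=.
  by rewrite !mxE subrr mul0r.
exists (pad a), (pad b); split; [|split].
- move=> m i; rewrite /pad; case: insub => [k|]; first exact: ab.
  by rewrite mxE.
- move=> x /Aab [k _ xk]; exists (enum_rank k) => //.
  by rewrite !padE enum_rankK.
- rewrite (nneseries_split 0 #|I|); last first.
    move=> m _; rewrite lee_fin box_vol_ge0 // => i; rewrite /pad.
    by case: insub => [k|]; rewrite ?ab ?mxE.
  rewrite eseries0 ?adde0; last by move=> m Im _; rewrite vol_pad.
  rewrite add0n big_mkord sumEFin lee_fin.
  under eq_bigr do rewrite !padE.
  by move: le_e; rewrite (big_enum_val (A := predT)).
Qed.

(* The m-th set is covered with total volume e / 2^(m+1), and the doubly indexed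
   family of boxes is re-enumerated along a bijection nat -> nat * nat. *)
Lemma lebesgue_null_bigcup (A : nat -> set 'cV[R]_n) :
  (forall m, lebesgue_null (A m)) -> lebesgue_null (\bigcup_m A m).
Proof.
move=> nA; apply: lebesgue_nullP => e e0.
have cov m : exists ab : (nat -> 'cV[R]_n) * (nat -> 'cV[R]_n),
   (forall k i, (ab.1 k i ord0 <= ab.2 k i ord0)%R) /\
   A m `<=` \bigcup_k box (ab.1 k) (ab.2 k) /\
   \sum_(k <oo) (box_vol (ab.1 k) (ab.2 k))%:E <= (e / (2 ^ m.+1)%:R)%:E.
  have : lebesgue_outer (A m) < (e / (2 ^ m.+1)%:R)%:E.
    by rewrite nA lte_fin divr_gt0 // ltr0n expn_gt0.
  move=> /ereal_inf_lt [_ [a [b [ab [Aab ->]]]] lt_e].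
  by exists (a, b); split => //; split => //; apply: ltW.
have [ab hab] := choice cov.
have [g gbij] : exists g : nat -> nat * nat, set_bij setT setT g.
  by apply/card_set_bijP; apply: card_esym; exact: card_nat2.
exists (fun k => (ab (g k).1).1 (g k).2), (fun k => (ab (g k).1).2 (g k).2).
split; first by move=> k i; case: (hab (g k).1) => + _; apply.
split.
  move=> x [m _ Amx]; have [_ [/(_ x Amx) [k _ xk] _]] := hab m.
  have [_ _ gsurj] := gbij.
  have [j _ gj] := gsurj (m, k) I.
  by exists j => //; rewrite gj.
pose u (p : nat * nat) := (box_vol ((ab p.1).1 p.2) ((ab p.1).2 p.2))%:E.
have u0 p : 0 <= u p by rewrite lee_fin box_vol_ge0 //; case: (hab p.1).
rewrite (_ : \sum_(k <oo) _ = \sum_(k <oo) u (g k)) //.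
rewrite nneseries_esumT // -(reindex_esum setT setT g u gbij).
rewrite (_ : [set: nat * nat] = setT `*`` (fun=> setT)); last first.
  by apply/seteqP; split => -[].
rewrite -(@esum_esum _ _ _ setT (fun=> setT) (fun i j => u (i, j))) //.
apply: (le_trans _ (epsilon_trick0 xpredT (ltW e0))).
rewrite nneseries_esumT; last by move=> m; rewrite lee_fin divr_ge0 // ltW.
apply: le_esum => m _.
by rewrite -nneseries_esumT //; case: (hab m) => _ [].
Qed.

Lemma lebesgue_null_bigcup_ord (r : nat) (l0 : 'I_r) (A : 'I_r -> set 'cV[R]_n) :
  (forall l, lebesgue_null (A l)) -> lebesgue_null (\bigcup_l A l).
Proof.
move=> nA; apply: (@lebesgue_null_sub _ (\bigcup_m A (insubd l0 m))).
  by move=> x [l _ Alx]; exists (l : nat) => //; rewrite valKd.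
exact: lebesgue_null_bigcup.
Qed.

End lebesgue_outer.

(* No measurability is needed: both integrals are suprema over the simple functions
   below the integrands. *)
Lemma ge0_le_integral_nonmeasurable d (T : measurableType d) (R : realType)
  (mu : {measure set T -> \bar R}) (D : set T) (f g : T -> \bar R) :
  (forall x, D x -> 0 <= f x) -> (forall x, D x -> f x <= g x) ->
  \int[mu]_(x in D) f x <= \int[mu]_(x in D) g x.
Proof.
move=> f0 fg.
have g0 x : D x -> 0 <= g x by move=> Dx; exact: le_trans (f0 _ Dx) (fg _ Dx).
rewrite !ge0_integralE //; apply: le_ereal_sup => _ [h hf <-]; exists h => //=.
move=> x; apply: le_trans (hf x) _; rewrite /patch; case: ifP => // /set_mem.
exact: fg.
Qed.

Lemma integral_scale_indic d (T : measurableType d) (R : realType)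
  (mu : {measure set T -> \bar R}) (D A : set T) (k : R) :
  measurable D -> measurable A -> (0 <= k)%R ->
  \int[mu]_(x in D) (k * \1_A x)%:E = k%:E * mu (A `&` D).
Proof.
move=> mD mA k0; rewrite (integralZl_indic _ (fun=> A)) ?integral_indic //.
by move=> /lt_le_trans /(_ k0); rewrite ltxx.
Qed.

Section iterated_integral.
Variables (R : realType) (n : nat).
Implicit Types a b x y : 'cV[R]_n.

Definition set_coord x (k : nat) (t : R) : 'cV[R]_n :=
  \col_i (if (i : nat) == k then t else x i ord0).

Fixpoint iter_integral (k : nat) (g : 'cV[R]_n -> \bar R) : 'cV[R]_n -> \bar R :=
  if k is k'.+1 then
    fun x => \int[@lebesgue_measure R]_(t in setT) iter_integral k' g (set_coord x k' t)
  else g.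

Lemma iter_integral_ge0 k (g : 'cV[R]_n -> \bar R) :
  (forall y, 0 <= g y) -> forall x, 0 <= iter_integral k g x.
Proof.
move=> g0; elim: k => [|k IH] x //=.
by apply: integral_ge0 => t _; exact: IH.
Qed.

Lemma le_iter_integral k (g h : 'cV[R]_n -> \bar R) : (forall y, 0 <= g y) ->
  (forall y, g y <= h y) -> forall x, iter_integral k g x <= iter_integral k h x.
Proof.
move=> g0 gh; elim: k => [|k IH] x //=.
apply: ge0_le_integral_nonmeasurable => t _; last exact: IH.
exact: iter_integral_ge0.
Qed.

Definition box_indic a b y : R :=
  \prod_(i < n) \1_(`[a i ord0, b i ord0]%classic : set R) (y i ord0).

(* [box_indic a b] with the coordinates [0, ..., k-1] integrated out *)
Definition partial_box_vol (k : nat) a b y : R :=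
  \prod_(i < n) (if (i < k)%N then b i ord0 - a i ord0
                 else \1_(`[a i ord0, b i ord0]%classic : set R) (y i ord0)).

Lemma box_indic_ge0 a b y : (0 <= box_indic a b y)%R.
Proof. by apply: prodr_ge0 => i _; rewrite indicE ler0n. Qed.

Lemma box_indic_in a b y : box a b y -> box_indic a b y = 1%R.
Proof.
move=> aby; rewrite /box_indic big1 // => i _; rewrite indicE mem_set //=.
by rewrite in_itv; exact: aby.
Qed.

Lemma box_indic_out a b y : ~ box a b y -> box_indic a b y = 0%R.
Proof.
move=> aby; have [i yi] : exists i, ~~ (a i ord0 <= y i ord0 <= b i ord0)%R.
  by apply/not_existsP => yab; apply: aby => i; have := yab i; case: (_ && _).
rewrite /box_indic (bigD1 i) //= indicE memNset ?mul0r //=.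
by rewrite in_itv /=; apply/negP.
Qed.

Lemma partial_box_vol_full a b y : partial_box_vol n a b y = box_vol a b.
Proof. by apply: eq_bigr => i _; rewrite ltn_ord. Qed.

Lemma partial_box_vol_set_coord (k : 'I_n) a b x :
  (forall i, a i ord0 <= b i ord0)%R -> exists2 C : R, (0 <= C)%R &
  (forall t, partial_box_vol k a b (set_coord x k t) =
               C * \1_(`[a k ord0, b k ord0]%classic : set R) t)%R /\
  partial_box_vol k.+1 a b x = (C * (b k ord0 - a k ord0))%R.
Proof.
move=> ab; pose C := (\prod_(i < n | i != k) (if (i < k)%N then b i ord0 - a i ord0
                 else \1_(`[a i ord0, b i ord0]%classic : set R) (x i ord0)))%R.
have ki i : i != k -> ((i : nat) == k) = false by move/negPf.
exists C.
  by apply: prodr_ge0 => i _; case: ifP; rewrite ?subr_ge0 ?indicE ?ler0n ?ab.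
split => [t|]; rewrite /partial_box_vol (bigD1 k) //= mulrC; congr (_ * _)%R.
- by apply: eq_bigr => i /ki ik; rewrite mxE ik.
- by rewrite ltnn mxE eqxx.
- by apply: eq_bigr => i /ki ik; rewrite ltnS leq_eqVlt ik.
- by rewrite ltnSn.
Qed.

Lemma integral_partial_box_vol (k : 'I_n) (w : R) a b x :
  (0 <= w)%R -> (forall i, a i ord0 <= b i ord0)%R ->
  \int[@lebesgue_measure R]_(t in setT)
    (w * partial_box_vol k a b (set_coord x k t))%:E =
  (w * partial_box_vol k.+1 a b x)%:E.
Proof.
move=> w0 ab; have [C C0 [vol_t ->]] := @partial_box_vol_set_coord k a b x ab.
under eq_integral do rewrite vol_t mulrA.
have len_ab :
    @lebesgue_measure R `[a k ord0, b k ord0]%classic = (b k ord0 - a k ord0)%:E.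
  rewrite lebesgue_measure_itv /= lte_fin.
  by case: ltgtP (ab k) => // -> _; rewrite subrr.
rewrite integral_scale_indic ?mulr_ge0 // setIT mulrA [in RHS]EFinM.
by congr (_ * _); exact: len_ab.
Qed.

Lemma measurable_partial_box_vol_set_coord (k : 'I_n) (w : R) a b x :
  (forall i, a i ord0 <= b i ord0)%R ->
  measurable_fun [set: R]
    (fun t => (w * partial_box_vol k a b (set_coord x k t))%:E : \bar R).
Proof.
move=> ab; have [C _ [vol_t _]] := @partial_box_vol_set_coord k a b x ab.
rewrite (funext (fun t => congr1 (fun v => (w * v)%:E) (vol_t t))).
by apply/measurable_EFinP; do 2 apply: measurable_funM => //.
Qed.

Lemma iter_integral_box_series (w : nat -> R) (a b : nat -> 'cV[R]_n) k :
  (forall j, 0 <= w j)%R -> (forall j i, a j i ord0 <= b j i ord0)%R ->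
  (k <= n)%N -> forall x,
  iter_integral k (fun y => \sum_(j <oo) (w j * box_indic (a j) (b j) y)%:E) x =
  \sum_(j <oo) (w j * partial_box_vol k (a j) (b j) x)%:E.
Proof.
move=> w0 ab; elim: k => [|k IH] kn x //=.
have ge0 j t : 0 <= (w j * partial_box_vol k (a j) (b j) t)%:E.
  rewrite lee_fin mulr_ge0 // prodr_ge0 // => i _.
  by case: ifP; rewrite ?subr_ge0 ?indicE ?ler0n ?ab.
under eq_integral do rewrite IH ?(ltnW kn) //.
rewrite (integral_nneseries _ measurableT); last 2 first.
- by move=> j; exact: (@measurable_partial_box_vol_set_coord (Ordinal kn)).
- by move=> j t _; exact: ge0.
by apply: eq_eseriesr => j _; exact: (@integral_partial_box_vol (Ordinal kn)).
Qed.

End iterated_integral.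

Section lebesgue_outer_disjoint_boxes.
Variables (R : realType) (n : nat).
Variables (K : nat) (c d : nat -> 'cV[R]_n).
Hypothesis cd : forall m i, (c m i ord0 <= d m i ord0)%R.
Hypothesis cd_disj : trivIset `I_K (fun m => box (c m) (d m)).

Lemma box_indic_disjoint_le_cover (a b : nat -> 'cV[R]_n) y :
  \bigcup_(m in `I_K) box (c m) (d m) `<=` \bigcup_k box (a k) (b k) ->
  \sum_(j <oo) ((j < K)%N%:R * box_indic (c j) (d j) y)%:E <=
  \sum_(j <oo) (1 * box_indic (a j) (b j) y)%:E.
Proof.
move=> cover.
have ge0 (w : R) (a' b' : 'cV[R]_n) : (0 <= w)%R -> 0 <= (w * box_indic a' b' y)%:E.
  by move=> w0; rewrite lee_fin mulr_ge0 // box_indic_ge0.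
have [[m0 m0K y_m0]|y_out] := pselect (exists2 m0, (m0 < K)%N & box (c m0) (d m0) y).
  rewrite (@nneseriesD1 _ _ m0) //; last by move=> j _; apply: ge0; rewrite ler0n.
  rewrite eseries0 ?adde0; last first.
    move=> j _ /= j_m0; case: ltnP => jK; last by rewrite mul0r.
    rewrite box_indic_out ?mulr0 // => y_j; move/eqP: j_m0; apply.
    by apply: cd_disj => //; exists y.
  have [k _ y_k] := cover y (ex_intro2 _ _ m0 m0K y_m0).
  rewrite m0K mul1r box_indic_in // (@nneseriesD1 _ _ k) //; last first.
    by move=> j _; apply: ge0.
  by rewrite mul1r box_indic_in // leeDl // nneseries_ge0 // => j _ _; apply: ge0.
rewrite eseries0; last first.
  move=> j _ _; case: ltnP => jK; last by rewrite mul0r.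
  by rewrite box_indic_out ?mulr0 // => y_j; apply: y_out; exists j.
by apply: nneseries_ge0 => j _ _; apply: ge0.
Qed.

Lemma sum_box_vol_le_cover (a b : nat -> 'cV[R]_n) :
  (forall k i, (a k i ord0 <= b k i ord0)%R) ->
  \bigcup_(m in `I_K) box (c m) (d m) `<=` \bigcup_k box (a k) (b k) ->
  (\sum_(m < K) box_vol (c m) (d m))%:E <= \sum_(k <oo) (box_vol (a k) (b k))%:E.
Proof.
move=> ab cover; pose w j : R := (j < K)%N%:R.
have ge0 y : 0 <= \sum_(j <oo) (w j * box_indic (c j) (d j) y)%:E.
  by apply: nneseries_ge0 => j _ _; rewrite lee_fin mulr_ge0 ?ler0n ?box_indic_ge0.
have := le_iter_integral n ge0 (fun y => box_indic_disjoint_le_cover y cover)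
  (const_mx 0%R).
rewrite (@iter_integral_box_series _ _ w) ?ler0n //.
rewrite (@iter_integral_box_series _ _ (fun=> 1%R)) ?ler01 //.
under eq_eseriesr do rewrite partial_box_vol_full.
under [X in _ <= X -> _]eq_eseriesr do rewrite partial_box_vol_full mul1r.
apply: le_trans.
rewrite (nneseries_split 0 K); last first.
  by move=> k _; rewrite lee_fin mulr_ge0 ?ler0n ?box_vol_ge0.
rewrite eseries0 ?adde0; last by move=> i iK _; rewrite /w ltnNge iK mul0r.
rewrite add0n big_mkord sumEFin lee_fin.
by apply: ler_sum => i _; rewrite /w ltn_ord mul1r.
Qed.

Lemma lebesgue_outer_disjoint_boxes_ge :
  (\sum_(m < K) box_vol (c m) (d m))%:E <=
  lebesgue_outer (\bigcup_(m in `I_K) box (c m) (d m)).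
Proof.
apply: le_ereal_inf_tmp => _ [a [b [ab [cover ->]]]].
exact: sum_box_vol_le_cover.
Qed.

End lebesgue_outer_disjoint_boxes.

Local Close Scope ereal_scope.

Lemma grid_cell (R : realType) (K : nat) (l h t : R) : (0 < K)%N -> (0 < h) ->
  (l <= t <= l + h * K%:R) -> exists i : 'I_K, (l + h * i%:R <= t <= l + h * i%:R + h).
Proof.
move=> K0 h0 /andP[lt th]; pose u := ((t - l) / h).
have u0 : (0 <= u) by rewrite divr_ge0 ?subr_ge0 // ltW.
have uK : (u <= K%:R) by rewrite ler_pdivrMr // mulrC lerBlDl.
have tu : t = (l + h * u) by rewrite /u mulrC divfK ?gt_eqF // addrC subrK.
have hS v : (l + h * v + h = l + h * (v + 1)) by ring.
pose i := minn (Num.trunc u) K.-1.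
have iK : (i < K)%N by rewrite (leq_ltn_trans (geq_minr _ _)) // prednK.
have ui : (i%:R <= u).
  by rewrite (le_trans _ (eqbRL (truncn_le u) u0)) // ler_nat geq_minl.
have ui1 : (u <= i%:R + 1).
  case: (leqP (Num.trunc u) K.-1) => [uK1|/ltnW K1u]; rewrite /i.
    by rewrite (minn_idPl uK1) natr1 ltW // truncnS_gt.
  by rewrite (minn_idPr K1u) natr1 prednK.
exists (Ordinal iK); rewrite tu hS /= !lerD2l !ler_pM2l //.
by apply/andP.
Qed.

Lemma hyperplane_coord_near (R : realType) (n : nat) (w x : 'cV[R]_n) (l : 'I_n -> R)
    (j : 'I_n) (h : R) :
  w j ord0 != 0 -> (\sum_k w k ord0 * x k ord0 = 0) ->
  (forall k, k != j -> l k <= x k ord0 <= l k + h) ->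
  (`|x j ord0 - \sum_(k | k != j) (- w k ord0 / w j ord0) * l k|
     <= (\sum_(k | k != j) `|w k ord0 / w j ord0|) * h).
Proof.
move=> wj0 hyp lxh.
have -> : x j ord0 = (\sum_(k | k != j) (- w k ord0 / w j ord0) * x k ord0).
  move: hyp; rewrite (bigD1 j) //= => /(canRL (addrK _)); rewrite add0r => wx.
  rewrite -[x j ord0](mulKf wj0) wx mulrN mulr_sumr -sumrN.
  by apply: eq_bigr => k _; ring.
rewrite -sumrB mulr_suml; apply: le_trans (ler_norm_sum _ _ _) _.
apply: ler_sum => k kj; rewrite -mulrBr normrM mulNr normrN ler_wpM2l //.
by have /andP[lx xh] := lxh k kj; rewrite ger0_norm ?subr_ge0 //; lra.
Qed.

Definition hyperplane_slab (R : realType) (n : nat) (w : 'cV[R]_n) (j : 'I_n) (M : R) :=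
  [set x : 'cV[R]_n | (\sum_k w k ord0 * x k ord0 = 0) /\
                      forall k, k != j -> (`|x k ord0| <= M)].

Lemma lebesgue_null_hyperplane_slab (R : realType) (n : nat) (w : 'cV[R]_n)
    (j : 'I_n) (M : R) :
  w j ord0 != 0 -> (0 < M) -> lebesgue_null (hyperplane_slab w j M).
Proof.
(* Cover by K^(n-1) boxes: a grid cell of side h = 2M/K in the coordinates other
   than j, times an interval of length 2Ch in coordinate j; their total volume is
   2C(2M)^n/K. *)
move=> wj0 M0; have n0 : (0 < n)%N by case: n j {w wj0} => [[]|].
apply: lebesgue_null_fin_cover => // e e0.
pose C := (\sum_(k | k != j) `|w k ord0 / w j ord0|).
have C0 : (0 <= C) by rewrite sumr_ge0.
pose K := (Num.trunc (2 * C * (2 * M) ^+ n / e)).+1.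
have K0 : (0 < K%:R :> R) by rewrite ltr0n.
pose h := (2 * M / K%:R).
have h0 : (0 < h) by rewrite divr_gt0 ?mulr_gt0.
have hK : (h * K%:R = 2 * M) by rewrite divfK ?gt_eqF.
pose lo (p : {ffun 'I_n.-1 -> 'I_K}) (k : 'I_n) : R :=
  if unlift j k is Some i then (- M + h * (p i)%:R) else 0.
pose cen p := (\sum_(k | k != j) (- w k ord0 / w j ord0) * lo p k).
pose a p : 'cV[R]_n := \col_k (if k == j then cen p - C * h else lo p k).
pose b p : 'cV[R]_n := \col_k (if k == j then cen p + C * h else lo p k + h).
have Ch0 : (0 <= C * h) by rewrite mulr_ge0 // ltW.
exists {ffun 'I_n.-1 -> 'I_K}, a, b; split; [|split].
- by move=> p k; rewrite !mxE; case: eqP => _; lra.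
- move=> x [hyp xM].
  have cell i : exists c : 'I_K,
      - M + h * c%:R <= x (lift j i) ord0 <= - M + h * c%:R + h.
    apply: grid_cell => //; rewrite hK.
    move: (xM (lift j i)); rewrite eq_sym neq_lift ler_norml => /(_ isT) /andP[].
    by move=> lo_x x_hi; apply/andP; split; lra.
  have [g xg] := choice cell; pose p := finfun g.
  have lo_x k : k != j -> (lo p k <= x k ord0 <= lo p k + h).
    by case: (unliftP j k) => [i ->|->]; rewrite ?eqxx // /lo liftK ffunE.
  exists p => //; move=> k; rewrite !mxE; case: eqP => [->|/eqP kj]; last exact: lo_x.
  by rewrite -ler_distl; exact: hyperplane_coord_near.
- have vol p : box_vol (a p) (b p) = (2 * C * h * h ^+ n.-1).
    rewrite /box_vol (bigD1 j) //= !mxE eqxx (eq_bigr (fun=> h)); last first.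
      by move=> k /negPf kj; rewrite !mxE kj addrAC subrr add0r.
    by rewrite prodr_const cardC1 card_ord; congr (_ * _); ring.
  rewrite (eq_bigr _ (fun p _ => vol p)) sumr_const card_ffun !card_ord.
  rewrite -(mulr_natr _ (K ^ n.-1)) natrX.
  have -> : (2 * C * h * h ^+ n.-1 * K%:R ^+ n.-1 = 2 * C * (2 * M) ^+ n / K%:R).
    rewrite -mulrA -exprMn hK -[in RHS](prednK n0) exprS -hK.
    by field; rewrite gt_eqF.
  have := truncnS_gt (2 * C * (2 * M) ^+ n / e); rewrite -/K ltr_pdivrMr // => XK.
  by rewrite ler_pdivrMr //; lra.
Qed.

Lemma lebesgue_null_hyperplane (R : realType) (n : nat) (w : 'cV[R]_n) (j : 'I_n) :
  w j ord0 != 0 -> lebesgue_null [set x : 'cV[R]_n | (\sum_k w k ord0 * x k ord0 = 0)].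
Proof.
move=> wj0; apply: (@lebesgue_null_sub _ _ _ (\bigcup_m hyperplane_slab w j m.+1%:R)).
  move=> x wx; exists (Num.trunc (\sum_k `|x k ord0|)) => //; split => // k _.
  apply: le_trans (ltW (truncnS_gt _)).
  by rewrite (bigD1 k) //= lerDl sumr_ge0.
by apply: lebesgue_null_bigcup => m; exact: lebesgue_null_hyperplane_slab.
Qed.

Lemma lebesgue_null_kernel (R : realType) (H D : nat) (V : 'M[R]_(H, D)) :
  V != 0 -> lebesgue_null [set x : 'cV[R]_D | (V *m x = 0)].
Proof.
move=> V0; have [i [j Vij]] : exists i j, V i j != 0.
  apply: contrapT => nV; move/eqP: V0; apply; apply/matrixP => i j; rewrite mxE.
  by apply/eqP; apply/negPn/negP => Vij; apply: nV; exists i, j.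
apply: (lebesgue_null_sub _ (@lebesgue_null_hyperplane _ _ (row i V)^T j _)).
  move=> x /= /matrixP /(_ i ord0); rewrite !mxE => Vx.
  by rewrite -{}[RHS]Vx; apply: eq_bigr => k _; rewrite !mxE.
by rewrite !mxE.
Qed.

Lemma bounded_derivative_lipschitz (R : realType) (n : nat) (P : 'cV[R]_n -> R) :
  bounded_derivative P ->
  exists2 L : R, 0 < L & forall y z, `|P y - P z| <= L * `|y - z|.
Proof.
move=> [dP [M dPM]]; exists (Num.max M 1); first by rewrite lt_max ltr01 orbT.
move=> y z; set v := y - z; pose phi (t : R) := P (z + t *: v).
have phi_quot t : (fun h : R => h^-1 *: ((phi \o shift t) (h *: 1) - phi t)) =
    (fun h : R => h^-1 *: ((P \o shift (z + t *: v)) (h *: v) - P (z + t *: v))).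
  apply/funext => h /=; rewrite /phi -[h%:A]/(h * 1) mulr1 scalerDl.
  by congr (_ *: (P _ - _)); rewrite addrCA.
have phi_derivable t : derivable phi t 1.
  by rewrite /derivable phi_quot; exact: diff_derivable.
have phi_derive t : is_derive t (1 : R) phi ('D_v P (z + t *: v)).
  have -> : 'D_v P (z + t *: v) = 'D_1 phi t by rewrite /derive phi_quot.
  exact: derivableP (phi_derivable t).
have phi_cont : {within `[0, 1], continuous phi}.
  apply: continuous_subspaceT => t; apply: differentiable_continuous.
  exact/derivable1_diffP/phi_derivable.
have [c _] := MVT_segment ler01 (fun t _ => phi_derive t) phi_cont.
rewrite /phi scale0r addr0 scale1r subr0 mulr1 /v [z + _]addrC subrK => ->.
by apply: le_trans (dPM _ _) _; rewrite ler_wpM2r // le_max lexx.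
Qed.

Lemma separated_seq_of_unbounded (R : realType) (V : normedModType R) (S : set V)
    (r : R) :
  (forall b : R, exists z, S z /\ b < `|z|) ->
  exists2 u : nat -> V, (forall m, S (u m)) &
    (forall m m', m != m' -> r < `|u m - u m'|).
Proof.
move=> far; have [zf zfP] := choice far.
pose u := fix u m := if m is m'.+1 then zf (`|u m'| + `|r|) else zf 0.
have u_gt m : `|u m| + `|r| < `|u m.+1| := (zfP _).2.
have u_incr m m' : (m < m')%N -> `|u m| + `|r| < `|u m'|.
  elim: m' => // m' IH; rewrite ltnS leq_eqVlt => /orP[/eqP ->|mm']; first exact: u_gt.
  by apply: lt_trans (IH mm') _; apply: le_lt_trans (u_gt m'); rewrite lerDl.
have u_sep m m' : (m < m')%N -> r < `|u m' - u m|.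
  move=> /u_incr; have := lerB_dist (u m') (u m); have := ler_norm r; lra.
exists u; first by case=> [|m]; exact: (zfP _).1.
by move=> m m'; rewrite neq_ltn => /orP[] /u_sep; rewrite // distrC.
Qed.

Section cube.
Variables (R : realType) (n : nat).

Definition cube (z : 'cV[R]_n) (s : R) := box (z - const_mx s) (z + const_mx s).

Lemma cube_le (z : 'cV[R]_n) (s : R) i : 0 <= s ->
  (z - const_mx s) i ord0 <= (z + const_mx s) i ord0.
Proof. by move=> s0; rewrite !mxE; lra. Qed.

Lemma cube_norm_le (z y : 'cV[R]_n) (s : R) : 0 <= s -> cube z s y -> `|y - z| <= s.
Proof.
move=> s0 zy; rewrite [`|_|]mx_normrE; apply: bigmax_le => // -[i j] _ /=.
by rewrite (ord1 j) !mxE; have := zy i; rewrite !mxE ler_distl; lra.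
Qed.

Lemma box_vol_cube (z : 'cV[R]_n) (s : R) :
  box_vol (z - const_mx s) (z + const_mx s) = (2 * s) ^+ n.
Proof.
rewrite /box_vol (eq_bigr (fun=> 2 * s)) ?prodr_const ?card_ord // => i _.
by rewrite !mxE; ring.
Qed.

Lemma trivIset_separated_cubes (D : set nat) (u : nat -> 'cV[R]_n) (s : R) : 0 <= s ->
  (forall m m', m != m' -> 2 * s < `|u m - u m'|) -> trivIset D (fun m => cube (u m) s).
Proof.
move=> s0 u_sep m m' _ _ [y [ym ym']]; apply: contrapT => /eqP /u_sep.
have := cube_norm_le s0 ym; have := cube_norm_le s0 ym'.
by have := ler_normB (y - u m') (y - u m); rewrite opprB addrC addrA subrK; lra.
Qed.

End cube.

Lemma pdf_superlevel_outer_le (R : realType) (n : nat) (P : 'cV[R]_n -> R) (e m : R) :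
  is_pdf P -> 0 < e -> 0 <= m ->
  (forall t, 0 <= t < e -> (m%:E <= lebesgue_outer [set z | (t < P z)%R])%E) ->
  m * e <= 1.
Proof.
move=> [_ P1] e0 m0 lb.
have len_e : @lebesgue_measure R `[0, e[%classic = e%:E.
  by rewrite lebesgue_measure_itv /= lte_fin e0 oppr0 adde0.
have : (\int[@lebesgue_measure R]_(t in `[0%R, +oo[%classic)
          (m * \1_(`[0, e[%classic : set R) t)%:E <= lebesgue_integral_nonneg P)%E.
  apply: ge0_le_integral_nonmeasurable => t _.
    by rewrite lee_fin mulr_ge0 // indicE ler0n.
  rewrite indicE; case: (boolP (t \in _)) => [|_]; last first.
    by rewrite mulr0 lebesgue_outer_ge0.
  by rewrite in_setE /= in_itv /= mulr1; exact: lb.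
rewrite P1 integral_scale_indic // setIidl; last first.
  by move=> t /=; rewrite !in_itv /= => /andP[-> _].
by move=> le1; rewrite -lee_fin; apply: le_trans le1; rewrite EFinM -len_e.
Qed.

Lemma pdf_vanishes_at_infinity (R : realType) (n : nat) (P : 'cV[R]_n -> R) :
  is_pdf P -> bounded_derivative P ->
  forall e, 0 < e -> exists r : R, forall z, r < `|z| -> P z < e.
Proof.
move=> pdfP bdP e e0; apply: contrapT => P_far.
have far b : exists z, e <= P z /\ b < `|z|.
  apply: contrapT => nfar; apply: P_far; exists b => z bz.
  by rewrite ltNge; apply/negP => ez; apply: nfar; exists z.
have [L L0 PL] := bounded_derivative_lipschitz bdP.
pose s := e / (2 * L); have s0 : 0 < s by rewrite divr_gt0 // mulr_gt0.
have Ls : L * s = e / 2 by rewrite /s; field; rewrite gt_eqF.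
have [u Pu u_sep] := @separated_seq_of_unbounded _ _ [set z | e <= P z] (2 * s) far.
have P_cube m y t : t < e / 2 -> cube (u m) s y -> t < P y.
  move=> te /(cube_norm_le (ltW s0)) yu.
  have Lyu : L * `|y - u m| <= e / 2 by rewrite -Ls ler_wpM2l // ltW.
  by have := PL y (u m); have := Pu m; rewrite ler_norml /= => ePu /andP[+ _]; lra.
pose K := (Num.trunc ((2 * s) ^+ n * (e / 2))^-1).+1.
have disj := @trivIset_separated_cubes _ _ `I_K _ _ (ltW s0) u_sep.
have : K%:R * (2 * s) ^+ n * (e / 2) <= 1.
  apply: (pdf_superlevel_outer_le pdfP); first by rewrite divr_gt0.
    by rewrite mulr_ge0 ?ler0n // exprn_ge0 // mulr_ge0 // ltW.
  move=> t /andP[t0 te].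
  have cd m i : (u m - const_mx s) i ord0 <= (u m + const_mx s) i ord0.
    exact: cube_le (ltW s0).
  apply: le_trans (le_trans (lebesgue_outer_disjoint_boxes_ge cd disj)
                            (le_lebesgue_outer _)).
  - rewrite (eq_bigr _ (fun m _ => box_vol_cube _ _)) sumr_const card_ord.
    by rewrite mulr_natl.
  - by move=> y [m _ ym]; exact: P_cube ym.
have X0 : 0 < (2 * s) ^+ n * (e / 2).
  by rewrite mulr_gt0 ?divr_gt0 // exprn_gt0 // mulr_gt0.
rewrite -mulrA -ler_pdivlMr // div1r => KX.
by have := truncnS_gt ((2 * s) ^+ n * (e / 2))^-1; rewrite -/K ltNge KX.
Qed.

Lemma piecewise_affine_scale_unbounded (R : realType) (D H r : nat)
    (f : 'cV[R]_D -> 'cV[R]_H) (Q : 'I_r -> set 'cV[R]_D)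
    (V : 'I_r -> 'M[R]_(H, D)) (a : 'I_r -> 'cV[R]_H) (x : 'cV[R]_D) :
  piecewise_affine f Q V a -> (forall l, V l *m x != 0) ->
  forall b : R, \forall d \near +oo, b < `|f (d *: x)|.
Proof.
move=> [cov aff] Vx b.
pose d_ l := (`|b| + `|a l|) / `|V l *m x|.
exists (\sum_l d_ l); split; first exact: num_real.
move=> d d_gt; have [l Ql] := cov (d *: x).
have Vx0 : 0 < `|V l *m x| by rewrite normr_gt0.
have d_ge0 l' : 0 <= d_ l' by rewrite divr_ge0.
have d_lt : d_ l < d.
  by apply: le_lt_trans d_gt; rewrite (bigD1 l) //= lerDl sumr_ge0.
have : `|b| + `|a l| < d * `|V l *m x| by rewrite -ltr_pdivrMr.
rewrite (aff _ _ Ql) -scalemxAr; have := lerB_normD (d *: (V l *m x)) (a l).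
rewrite normrZ ger0_norm; last exact: le_trans (d_ge0 l) (ltW d_lt).
by have := ler_norm b; lra.
Qed.

Theorem theorem1 (R : realType) (D H r : nat)
    (f : 'cV[R]_D -> 'cV[R]_H) (Q : 'I_r -> set 'cV[R]_D)
    (V : 'I_r -> 'M[R]_(H, D)) (a : 'I_r -> 'cV[R]_H)
    (P : 'cV[R]_H -> R) :
  (0 < H)%N ->
  continuous f ->
  piecewise_affine f Q V a ->
  (forall l, row_free (V l)) ->
  is_pdf P ->
  bounded_derivative P ->
  exists N : set 'cV[R]_D, lebesgue_null N /\
    forall x, ~ N x ->
      (P (f (d *: x)) @[d --> +oo] --> 0) /\
      (forall NH : R, 0 < NH -> NH * P (f (d *: x)) @[d --> +oo] --> 0).
Proof.
move=> H0 _ fQVa V_free pdfP bdP.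
have [l0 _] := fQVa.1 0.
have V0 l : V l != 0.
  by apply/eqP => Vl0; move: (V_free l); rewrite /row_free Vl0 mxrank0 eq_sym gtn_eqF.
exists (\bigcup_l [set x | V l *m x = 0]); split.
  by apply: (lebesgue_null_bigcup_ord l0) => l; exact: lebesgue_null_kernel.
move=> x Nx; have Vx l : V l *m x != 0 by apply/eqP => Vlx; apply: Nx; exists l.
have P_cvg0 : P (f (d *: x)) @[d --> +oo] --> 0.
  apply/cvgr0Pnorm_lt => e e0; have [b Pb] := pdf_vanishes_at_infinity pdfP bdP e0.
  near=> d; rewrite ger0_norm; last by case: pdfP.
  by apply: Pb; near: d; exact: piecewise_affine_scale_unbounded fQVa Vx b.
by split => // NH _; rewrite -(mulr0 NH); exact: cvgMl_tmp.
Unshelve. all: by end_near. Qed.
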